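(* Let $\Omega\subset\mathbb{R}^n$ be a bounded $C^2$ domain and $\chi>0$. Let $$\lambda_N^{\ast}=\sup\{\lambda_0>0:\ (S^N_\lambda)\text{ has a solution for every }0\le\lambda\le\lambda_0\},$$ $$D_1=\{\lambda_0>0:\ (S^N_\lambda)\text{ has no solution for any }\lambda\ge\lambda_0\},$$ and let $\lambda_N=\inf D_1$ if $D_1\neq\emptyset$, $\lambda_N=\infty$ if $D_1=\emptyset$. Then $$\lambda_N\ \ge\ \lambda_N^{\ast}\ \ge\ \lambda^{\ast}\Bigl(1+\chi\int_\Omega\frac{dx}{1-w_\ast}\Bigr)^2>0,$$ $(S^N_\lambda)$ has a solution for every $0\le\lambda<\lambda_N^{\ast}$, and $(S^N_\lambda)$ has no solution for any $\lambda>\lambda_N$.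
   Context: For $\lambda\ge0$ consider the local problem $(S_\lambda)$: $-\Delta w=\frac{\lambda}{(1-w)^2}$ in $\Omega$, $w=0$ on $\partial\Omega$, and the nonlocal problem $(S^N_\lambda)$: $-\Delta v=\frac{\lambda}{(1-v)^2\left(1+\chi\int_\Omega\frac{dx}{1-v}\right)^2}$ in $\Omega$, $v=0$ on $\partial\Omega$. A solution of either problem is a function in $C^2(\Omega)\cap C(\overline\Omega)$ with values in $[0,1)$ on $\Omega$ that satisfies the problem classically. Known facts (Ghoussoub–Guo): there is a constant $\lambda^{\ast}\in(0,\infty)$ (the pull-in voltage) such that $(S_\lambda)$ has no solution for $\lambda>\lambda^{\ast}$, and for each $0\le\lambda<\lambda^{\ast}$ there is a unique minimal solution $w_\lambda$ of $(S_\lambda)$ (the pointwise smallest solution); for each $x\in\Omega$, $\lambda\mapsto w_\lambda(x)$ is strictly increasing and differentiable on $(0,\lambda^{\ast})$. Set $w_{\ast}=\lim_{\lambda\nearrow\lambda^{\ast}}w_\lambda$ (pointwise), so $0\le w_\ast\le1$. It is known that $\int_\Omega\frac{dx}{1-w_{\ast}}<\infty$. *)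

(* Defs.v *)
From HB Require Import structures.
From mathcomp Require Import all_boot all_order all_algebra.
From mathcomp Require Import all_classical all_reals all_analysis.
From mathcomp Require Import measurable_realfun.

Set Implicit Arguments.
Unset Strict Implicit.
Unset Printing Implicit Defensive.

Import Order.TTheory GRing.Theory Num.Theory.
Import numFieldNormedType.Exports.

Local Open Scope classical_set_scope.
Local Open Scope ring_scope.

(* 'rV[R]_n carries its Borel sigma-algebra, generated by the open sets. *)
HB.instance Definition _ (R : realType) (n : nat) :=
  Measurable.copy 'rV[R]_n (g_sigma_algebraType (@open 'rV[R]_n)).

Section lebesgue_measure_rV.
Context {R : realType}.

Let rat_ball n (qk : 'rV[rat]_n * nat) : set 'rV[R]_n :=
  ball (map_mx ratr qk.1 : 'rV[R]_n) qk.2.+1%:R^-1.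

Let open_bigcup_rat_ball n (U : set 'rV[R]_n) : open U ->
  U = \bigcup_(qk in [set qk | rat_ball qk `<=` U]) rat_ball qk.
Proof.
move=> oU; apply/seteqP; split; last by move=> x [qk]; exact.
move=> x Ux; have /nbhs_ballP[e /= e0 eU] : nbhs x U by exact: open_nbhs_nbhs.
have [k ke] : exists k : nat, k.+1%:R^-1 < e / 2.
  have e20 : 0 < e / 2 by rewrite divr_gt0.
  have [N _ h] := near_infty_natSinv_lt (PosNum e20); have /= {}h := h N (leqnn N).
  by exists N.
have k0 : 0 < k.+1%:R^-1 :> R by rewrite invr_gt0.
have /choice[q xq] (i : 'I_n) : exists q : rat, ball (x 0 i) k.+1%:R^-1 (ratr q).
  have [y [bxy [q _ qy]]] :
      ball (x 0 i) k.+1%:R^-1 `&` (@ratr R @` setT) !=set0.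
    apply: dense_rat; last exact: ball_open.
    by exists (x 0 i); exact: ballxx.
  by exists q; rewrite qy.
have qx : ball (map_mx ratr (\row_i q i) : 'rV[R]_n) k.+1%:R^-1 x.
  by split=> // i j; rewrite !mxE ord1; exact/ball_sym/xq.
exists (\row_i q i, k) => //= y qy; apply: eU.
apply: (@le_ball _ _ x (k.+1%:R^-1 + k.+1%:R^-1)).
  by rewrite (splitr e) lerD// ltW.
exact: ball_triangle (ball_sym qx) qy.
Qed.

Lemma measurable_fun_rV d (T : measurableType d) n (f : T -> 'rV[R]_n) :
  (forall i, measurable_fun setT (fun t => f t 0 i : measurableTypeR R)) ->
  measurable_fun setT f.
Proof.
move=> mf; apply: (measurability (@open 'rV[R]_n)) => //.
move=> _ [U oU <-]; rewrite setTI (open_bigcup_rat_ball oU) preimage_bigcup.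
rewrite bigcup_mkcond; apply: countable_bigcupT_measurable => [|[q k]]; first exact: countableP.
case: ifPn => // _.
have -> : f @^-1` rat_ball (q, k) =
    \bigcap_(i : 'I_n) (fun t => f t 0 i) @^-1` ball (ratr (q 0 i) : R) k.+1%:R^-1.
  apply/seteqP; split => [t [_ h] i _|t h]; first by have := h 0 i; rewrite mxE.
  split; first by rewrite /= invr_gt0.
  by move=> i j; rewrite !mxE !ord1; exact: h.
apply: fin_bigcap_measurable => [|i _]; first exact: finite_finset.
rewrite -[X in measurable X]setTI; apply: mf => //.
exact: measurable_ball.
Qed.

Lemma measurable_coord_rV n (i : 'I_n) :
  measurable_fun setT (fun v : 'rV[R]_n => v 0 i : measurableTypeR R).
Proof.
apply: (measurability _ (RGenOpens.measurableE R)).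
move=> _ [_ [a [b ->] <-]]; rewrite setTI; apply: sub_sigma_algebra.
apply: open_comp; last exact: interval_open.
by move=> v _; exact: coord_continuous.
Qed.

Definition rV_cons n (p : measurableTypeR R * 'rV[R]_n) : 'rV[R]_n.+1 :=
  row_mx (const_mx p.1 : 'rV[R]_1) p.2.

Lemma measurable_rV_cons n : measurable_fun setT (@rV_cons n).
Proof.
apply: measurable_fun_rV => i; under eq_fun do rewrite mxE.
case: fintype.split => j.
  by under eq_fun do rewrite mxE; exact: measurable_fst.
exact: measurableT_comp (measurable_coord_rV j) measurable_snd.
Qed.

Section step.
Variables (n : nat) (m : {measure set 'rV[R]_n -> \bar R}).
Local Open Scope ereal_scope.

Definition prod_lebesgue_rV : set 'rV[R]_n.+1 -> \bar R :=
  pushforward (lebesgue_measure \x^ m) (@rV_cons n).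

Let push : {measure set 'rV[R]_n.+1 -> \bar R} :=
  measure_function_pushforward__canonical__measure_function_Measure
    (lebesgue_measure \x^ m) (@measurable_rV_cons n).

Let prod0 : prod_lebesgue_rV set0 = 0. Proof. exact: (measure0 push). Qed.

Let prod_ge0 A : 0 <= prod_lebesgue_rV A. Proof. exact: (measure_ge0 push). Qed.

Let prod_sigma_additive : semi_sigma_additive prod_lebesgue_rV.
Proof. exact: (@measure_semi_sigma_additive _ _ _ push). Qed.

HB.instance Definition _ := isMeasure.Build _ _ _ prod_lebesgue_rV
  prod0 prod_ge0 prod_sigma_additive.

End step.

(* n-dimensional Lebesgue measure on Borel sets: the n-fold product of
   lebesgue_measure, transported along R * 'rV_n -> 'rV_n.+1 *)
Fixpoint lebesgue_rV (n : nat) : {measure set 'rV[R]_n -> \bar R} :=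
  if n is n'.+1 then prod_lebesgue_rV (lebesgue_rV n') else @dirac _ 'rV[R]_0 0 R.

End lebesgue_measure_rV.

Section mems_problems.
Context {R : realType} {n : nat}.
Implicit Types (Omega : set 'rV[R]_n) (u : 'rV[R]_n -> R) (lambda chi : R).

Definition basis_rV (i : 'I_n) : 'rV[R]_n := delta_mx 0 i.

Definition C1_on Omega u : Prop :=
  (forall x, Omega x -> {for x, continuous u}) /\
  (forall i x, Omega x ->
     derivable u x (basis_rV i) /\ {for x, continuous ('D_(basis_rV i) u)}).

Definition C2_on Omega u : Prop :=
  C1_on Omega u /\ forall i, C1_on Omega ('D_(basis_rV i) u).

Definition laplacian u (x : 'rV[R]_n) : R :=
  \sum_i 'D_(basis_rV i) ('D_(basis_rV i) u) x.

End mems_problems.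

Section domains.
Context {R : realType} {n : nat}.
Implicit Types Omega : set 'rV[R]_n.

(* Near each boundary point Omega lies, up to relabelling and reorienting the
   axes, strictly above the graph of a C^2 function of the n - 1 remaining
   coordinates, [col' k x]; s is the orientation of the k-th axis. *)
Definition C2_boundary Omega : Prop :=
  forall p, (closure Omega `\` Omega) p ->
  exists (r : R) (k : 'I_n) (s : bool) (gamma : 'rV[R]_n.-1 -> R),
    [/\ 0 < r, C2_on setT gamma &
     Omega `&` ball p r =
       [set x | gamma (col' k x) < (-1) ^+ s * x 0 k] `&` ball p r].

Definition bounded_C2_domain Omega : Prop :=
  [/\ Omega !=set0, open Omega, connected Omega, bounded_set Omega &
      C2_boundary Omega].

End domains.

Section mems_solutions.
Context {R : realType} {n : nat}.
Implicit Types (Omega : set 'rV[R]_n) (u v w : 'rV[R]_n -> R).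
Implicit Types (lambda chi : R).

(* The integral of 1 / (1 - u) over Omega, in \bar R: the inverse is the
   extended real one, so that 1 / 0 = +oo (u may reach the value 1). *)
Definition gap_integral Omega u : \bar R :=
  (\int[lebesgue_rV n]_(x in Omega) ((1 - u x)%:E)^-1)%E.

(* Functions are total; only their values on the closure of Omega matter. *)
Definition admissible Omega u : Prop :=
  [/\ C2_on Omega u, {within closure Omega, continuous u},
      (forall x, Omega x -> 0 <= u x < 1) &
      (forall x, (closure Omega `\` Omega) x -> u x = 0)].

Definition local_solution Omega lambda w : Prop :=
  admissible Omega w /\
  forall x, Omega x -> - laplacian w x = lambda / (1 - w x) ^+ 2.

(* [fine] is harmless here: on a bounded Omega an admissible v is bounded away
   from 1, hence its gap integral is finite. *)
Definition nonlocal_solution Omega chi lambda v : Prop :=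
  admissible Omega v /\
  forall x, Omega x ->
    - laplacian v x =
      lambda / ((1 - v x) ^+ 2 * (1 + chi * fine (gap_integral Omega v)) ^+ 2).

Definition local_solvable Omega lambda : Prop :=
  exists w, local_solution Omega lambda w.

Definition nonlocal_solvable Omega chi lambda : Prop :=
  exists v, nonlocal_solution Omega chi lambda v.

Definition minimal_solution Omega lambda w : Prop :=
  local_solution Omega lambda w /\
  forall u, local_solution Omega lambda u -> forall x, Omega x -> w x <= u x.

(* [lambda_star] is the pull-in voltage of (S_lambda) and [w] its minimal
   branch, with the properties established by Ghoussoub and Guo. *)
Record pull_in_branch Omega (lambda_star : R) (w : R -> 'rV[R]_n -> R) : Prop :=
  PullInBranch {
    pull_in_gt0 : 0 < lambda_star;
    pull_in_unsolvable : forall lambda,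
      lambda_star < lambda -> ~ local_solvable Omega lambda;
    pull_in_minimal : forall lambda,
      0 <= lambda < lambda_star -> minimal_solution Omega lambda (w lambda);
    pull_in_increasing : forall x, Omega x -> forall l1 l2,
      0 < l1 -> l1 < l2 -> l2 < lambda_star -> w l1 x < w l2 x;
    pull_in_derivable : forall x, Omega x -> forall lambda,
      0 < lambda < lambda_star -> derivable (fun l => w l x) lambda 1 }.

Definition pull_in_limit (lambda_star : R) (w : R -> 'rV[R]_n -> R)
    (x : 'rV[R]_n) : R :=
  lim (w lambda x @[lambda --> lambda_star^'-]).

Definition nonlocal_threshold Omega chi : \bar R :=
  ereal_sup [set lambda0%:E | lambda0 in [set lambda0 | 0 < lambda0 /\
    forall lambda, 0 <= lambda <= lambda0 -> nonlocal_solvable Omega chi lambda]].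

Definition D1 Omega chi : set R :=
  [set lambda0 | 0 < lambda0 /\
    forall lambda, lambda0 <= lambda -> ~ nonlocal_solvable Omega chi lambda].

(* [ereal_inf set0 = +oo] covers the case where D1 is empty. *)
Definition nonlocal_unsolvable_threshold Omega chi : \bar R :=
  ereal_inf [set lambda0%:E | lambda0 in D1 Omega chi].

End mems_solutions.

(* Main.v *)
Require Import Defs.
From mathcomp Require Import all_boot all_order all_algebra.
From mathcomp Require Import all_classical all_reals all_analysis.
From mathcomp Require Import measurable_realfun lra.

(* If w solves (S_l), then its gap integral I(w) is a constant, so w also
   solves the nonlocal problem with parameter l (1 + chi I(w))^2. Along the
   minimal branch this parameter is continuous in l on ]0, lambda_star[ by
   dominated convergence, it is at most l (1 + chi I(w_star))^2, hence small
   for small l, and it tends to the claimed bound as l increases to lambda_star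
   by monotone convergence. The intermediate value theorem then yields every
   value strictly between 0 and the bound. *)

Set Implicit Arguments.
Unset Strict Implicit.
Unset Printing Implicit Defensive.

Import Order.TTheory GRing.Theory Num.Theory.
Import numFieldNormedType.Exports.

Local Open Scope classical_set_scope.
Local Open Scope ring_scope.

(** * Measurability and limits of gap integrands *)

Lemma open_setI_preimage (S T : topologicalType) (f : S -> T) (D : set S)
    (U : set T) :
  open D -> open U -> (forall x, D x -> {for x, continuous f}) ->
  open (D `&` f @^-1` U).
Proof.
move=> oD oU cf; rewrite openE => x [Dx Ux].
apply: filterI; first exact: open_nbhs_nbhs.
by apply: cf => //; exact: open_nbhs_nbhs.
Qed.

(** Continuity holds only at points of [D], so the preimage of an open interval need not be open,
    but its trace on the open set [D] is, and open sets generate the Borel sigma-algebra. *)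
Lemma open_continuous_measurable_rV (R : realType) n (D : set 'rV[R]_n)
    (u : 'rV[R]_n -> R) :
  open D -> (forall x, D x -> {for x, continuous u}) ->
  measurable_fun D (u : 'rV[R]_n -> measurableTypeR R).
Proof.
move=> oD cu; apply: (measurability _ (RGenOpens.measurableE R)).
move=> _ [_ [a [b ->] <-]]; apply: sub_sigma_algebra.
by apply: open_setI_preimage => //; exact: interval_open.
Qed.

Lemma open_measurable_rV (R : realType) n (D : set 'rV[R]_n) :
  open D -> measurable D.
Proof. exact: sub_sigma_algebra. Qed.

Lemma continuous_inv_subr (R : realType) (T : topologicalType) (u : T -> R) x :
  u x != 1 -> {for x, continuous u} ->
  {for x, continuous (fun y => (1 - u y)^-1)}.
Proof.
move=> ux cu; apply: cvgV; first by rewrite subr_eq0 eq_sym.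
by apply: cvgB; [exact: cvg_cst|exact: cu].
Qed.

Lemma inve_subr_lt1 (R : realType) (a : R) :
  a < 1 -> ((1 - a)%:E^-1)%E = ((1 - a)^-1)%:E.
Proof. by move=> a1; rewrite inver gt_eqF// subr_gt0. Qed.

(** If [l = 1], then [1 - a k] tends to 0 through positive values and its inverse to [+oo], the
    extended inverse of 0. This case occurs where the limit of the branch reaches 1. *)
Lemma cvg_inve_subr (R : realType) (a : R^nat) (l : R) :
  (forall k, a k < 1) -> a @ \oo --> l ->
  ((1 - a k)%:E^-1)%E @[k --> \oo] --> ((1 - l)%:E^-1)%E.
Proof.
move=> a1 al; under eq_fun do rewrite inve_subr_lt1//.
have al1 : 1 - a k @[k --> \oo] --> 1 - l by apply: cvgB => //; exact: cvg_cst.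
rewrite inver; case: eqP => [l1|/eqP l1].
  apply/cvgeryP/cvgrVy; last by rewrite -l1.
  by apply: nearW => k; rewrite subr_gt0.
by apply: cvg_EFin; [exact: nearW|exact: cvgV].
Qed.

(** * Order properties of the two thresholds, and the passage from local to nonlocal solutions *)

Section thresholds.
Context {R : realType} {n : nat}.
Implicit Types (Omega : set 'rV[R]_n) (chi lambda : R).

Lemma nonlocal_solvable_below Omega chi lambda : 0 <= lambda ->
  (lambda%:E < nonlocal_threshold Omega chi)%E ->
  nonlocal_solvable Omega chi lambda.
Proof.
move=> l0 /ereal_sup_gt[_ [l1 [_ solv] <-]]; rewrite lte_fin => ll1.
by apply: solv; rewrite l0 ltW.
Qed.

Lemma nonlocal_unsolvable_above Omega chi lambda :
  (nonlocal_unsolvable_threshold Omega chi < lambda%:E)%E ->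
  ~ nonlocal_solvable Omega chi lambda.
Proof.
move=> /ereal_inf_lt[_ [l1 [_ unsolv] <-]]; rewrite lte_fin => l1l.
by apply: unsolv; exact: ltW.
Qed.

(** If some [l1] in [D1] were below an [l0] up to which all parameters are solvable, [l0] itself
    would be both solvable and unsolvable. *)
Lemma nonlocal_threshold_le Omega chi :
  (nonlocal_threshold Omega chi <= nonlocal_unsolvable_threshold Omega chi)%E.
Proof.
apply: ge_ereal_sup => _ [l0 [l00 solv] <-].
apply: le_ereal_inf_tmp => _ [l1 [l10 unsolv] <-]; rewrite lee_fin leNgt.
apply/negP => l1l0; apply: (unsolv l0 (ltW l1l0)).
by apply: solv; rewrite lexx ltW.
Qed.

Lemma nonlocal_threshold_ge Omega chi (b : R) : 0 < b ->
  (forall lambda, 0 <= lambda < b -> nonlocal_solvable Omega chi lambda) ->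
  (b%:E <= nonlocal_threshold Omega chi)%E.
Proof.
move=> b0 solv; apply/lee_addgt0Pr => e e0.
(* [b] itself need not be solvable, so the supremum is tested at [b - m]: [m <= e] bounds the loss,
   and [m <= b / 2] keeps [b - m] positive. *)
pose m := Num.min e (b / 2).
have m0 : 0 < m by rewrite lt_min e0 divr_gt0.
have [me mb] : m <= e /\ m <= b / 2 by rewrite !ge_min !lexx orbT.
apply: (@le_trans _ _ ((b - m)%:E + e%:E)%E); first by rewrite -EFinD lee_fin; lra.
apply: leeD2r; apply: ereal_sup_ubound; exists (b - m) => //; split; first lra.
by move=> l /andP[l0 lb]; apply: solv; rewrite l0; lra.
Qed.

Lemma gap_integral_ge0 Omega (u : 'rV[R]_n -> R) :
  (forall x, Omega x -> u x <= 1) -> (0 <= gap_integral Omega u)%E.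
Proof.
move=> u1; apply: integral_ge0 => x /u1 ux1.
by rewrite inver; case: eqP => // _; rewrite lee_fin invr_ge0 subr_ge0.
Qed.

(** The factor cancels because it is nonzero: [fine] of a nonnegative extended real is nonnegative
    ([+oo] being sent to 0), so [1 + chi * fine _] is positive. *)
Lemma local_solution_nonlocal Omega chi lambda (u : 'rV[R]_n -> R) :
  0 < chi -> local_solution Omega lambda u ->
  nonlocal_solution Omega chi
    (lambda * (1 + chi * fine (gap_integral Omega u)) ^+ 2) u.
Proof.
move=> chi0 [adm eqn]; split=> // x Ox; rewrite eqn//.
have [_ _ u01 _] := adm.
have s0 : 0 < 1 + chi * fine (gap_integral Omega u).
  rewrite ltr_pwDl// mulr_ge0 ?(ltW chi0)// fine_ge0// gap_integral_ge0//.
  by move=> y /u01/andP[_ /ltW].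
have t0 : 0 < 1 - u x by have /andP[_ ?] := u01 x Ox; rewrite subr_gt0.
by rewrite -mulf_div divff ?mulr1// gt_eqF// exprn_gt0.
Qed.

End thresholds.

(** * Pointwise bounds, monotonicity and measurability along the minimal branch *)

Section pull_in_branch.
Context {R : realType} {n : nat}.
Context {Omega : set 'rV[R]_n} {lambda_star : R} {w : R -> 'rV[R]_n -> R}.
Context (oOmega : open Omega) (branch : pull_in_branch Omega lambda_star w).
Let mu : {measure set 'rV[R]_n -> \bar R} := lebesgue_rV n.
Let w_star := pull_in_limit lambda_star w.
Let mOmega : measurable Omega := open_measurable_rV oOmega.

Lemma branch_solution l : 0 <= l < lambda_star -> local_solution Omega l (w l).
Proof. by move=> /(pull_in_minimal branch)[]. Qed.

Lemma branch_bounds l x : 0 <= l < lambda_star -> Omega x -> 0 <= w l x < 1.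
Proof. by move=> /branch_solution[[_ _ + _] _] Ox; exact. Qed.

Lemma branch_lt1 l x : 0 <= l < lambda_star -> Omega x -> w l x < 1.
Proof. by move=> l01 /(branch_bounds l01)/andP[]. Qed.

Lemma branch_le x l1 l2 : Omega x -> 0 < l1 -> l1 <= l2 -> l2 < lambda_star ->
  w l1 x <= w l2 x.
Proof.
move=> Ox l10; rewrite le_eqVlt => /predU1P[->//|l12] l2s.
exact: ltW (pull_in_increasing branch Ox l10 l12 l2s).
Qed.

Lemma branch_continuous x l : Omega x -> 0 < l < lambda_star ->
  {for l, continuous (w^~ x)}.
Proof.
move=> Ox ls; apply: differentiable_continuous; apply/derivable1_diffP.
exact: pull_in_derivable branch _ Ox _ ls.
Qed.

Lemma measurable_branch_gap l : 0 <= l < lambda_star ->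
  measurable_fun Omega (fun x => ((1 - w l x)%:E^-1)%E).
Proof.
move=> ls; have [[[[cw _] _] _ _ _] _] := branch_solution ls.
apply: (eq_measurable_fun (fun x => ((1 - w l x)^-1)%:E)) => [x /[!inE] Ox|].
  by rewrite inve_subr_lt1// branch_lt1.
apply/measurable_EFinP; apply: open_continuous_measurable_rV => // x Ox.
by apply: continuous_inv_subr; [rewrite lt_eqF ?branch_lt1|exact: cw].
Qed.

Lemma branch_gap_ge0 l : 0 <= l < lambda_star ->
  (0 <= gap_integral Omega (w l))%E.
Proof. by move=> ls; apply: gap_integral_ge0 => x Ox; exact/ltW/branch_lt1. Qed.

Lemma branch_gap_le l1 l2 : 0 < l1 -> l1 <= l2 -> l2 < lambda_star ->
  (gap_integral Omega (w l1) <= gap_integral Omega (w l2))%E.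
Proof.
move=> l10 l12 l2s.
have l1s : 0 <= l1 < lambda_star by rewrite ltW//=; exact: le_lt_trans l2s.
have l2s' : 0 <= l2 < lambda_star by rewrite l2s andbT (le_trans (ltW l10)).
have gap_lt1 l x : 0 <= l < lambda_star -> Omega x -> 0 < 1 - w l x.
  by move=> ls Ox; rewrite subr_gt0 branch_lt1.
apply: ge0_le_integral => // [x Ox|||x Ox].
- by rewrite inve_subr_lt1 ?branch_lt1// lee_fin invr_ge0 ltW// gap_lt1.
- exact: measurable_branch_gap.
- exact: measurable_branch_gap.
- rewrite !inve_subr_lt1 ?branch_lt1// lee_fin lef_pV2 ?posrE ?gap_lt1//.
  by rewrite lerD2l lerN2 branch_le.
Qed.

(** [w_star] is defined by [lim], which is meaningful only once convergence is known. It follows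
    from monotonicity on a left neighbourhood of positive parameters and the upper bound 1. *)
Lemma cvg_branch x : Omega x -> w l x @[l --> lambda_star^'-] --> w_star x.
Proof.
move=> Ox; have ls0 := pull_in_gt0 branch.
apply: nondecreasing_at_left_is_cvgr; near=> l.
  have l0 : 0 < l by near: l; exact: nbhs_left_gt.
  move=> a b; rewrite !in_itv/= => /andP[la _] /andP[_ bs] ab.
  by rewrite branch_le// (lt_trans l0).
have l0 : 0 < l by near: l; exact: nbhs_left_gt.
exists 1 => _ [a /= + <-]; rewrite in_itv/= => /andP[la als].
by rewrite ltW// branch_lt1// als andbT ltW// (lt_trans l0).
Unshelve. all: by end_near. Qed.

(** * Monotone convergence along a sequence of parameters rising from [lambda_star / 2] to
    [lambda_star] *)

Let lambda_seq (k : nat) : R := lambda_star - lambda_star / 2 * harmonic k.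

Lemma lambda_seq_itv k : 0 < lambda_seq k < lambda_star.
Proof.
have ls0 := pull_in_gt0 branch.
have h0 : 0 < harmonic k :> R by exact: harmonic_gt0.
have h1 : harmonic k <= 1 :> R by rewrite invf_le1 ?ler1n.
rewrite /lambda_seq; apply/andP; split; nra.
Qed.

Lemma cvg_lambda_seq : lambda_seq @ \oo --> lambda_star.
Proof.
rewrite -[X in _ --> X](subr0 lambda_star) -(mulr0 (lambda_star / 2)).
apply: cvgB; first exact: cvg_cst.
by apply: cvgM; [exact: cvg_cst|exact: cvg_harmonic].
Qed.

Lemma lambda_seq_nd : nondecreasing_seq lambda_seq.
Proof.
have ls0 := pull_in_gt0 branch.
move=> i j ij; rewrite /lambda_seq lerD2l lerN2 ler_pM2l ?divr_gt0//.
by rewrite lef_pV2 ?posrE// ler_nat ltnS.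
Qed.

Let lambda_seqW k : 0 <= lambda_seq k < lambda_star.
Proof. by have /andP[/ltW -> ->] := lambda_seq_itv k. Qed.

Lemma cvg_branch_seq x : Omega x -> w (lambda_seq k) x @[k --> \oo] --> w_star x.
Proof.
move=> Ox; have /cvg_at_leftP := cvg_branch Ox; apply; split.
  by move=> k; have /andP[] := lambda_seq_itv k.
exact: cvg_lambda_seq.
Qed.

Lemma w_star_le1 x : Omega x -> w_star x <= 1.
Proof.
move=> Ox; apply: (@cvgr_to_le _ _ _ _ _ _ _ (cvg_branch_seq Ox)).
by apply: nearW => k; exact/ltW/branch_lt1.
Qed.

(** Monotone convergence in [\bar R]: the integrands are nonnegative, increase with [k], and tend
    pointwise to the extended inverse, which is [+oo] where [w_star] equals 1. *)
Lemma cvg_branch_gap :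
  gap_integral Omega (w (lambda_seq k)) @[k --> \oo] --> gap_integral Omega w_star.
Proof.
have gap_cvg x : Omega x ->
    ((1 - w (lambda_seq k) x)%:E^-1)%E @[k --> \oo] --> ((1 - w_star x)%:E^-1)%E.
  move=> Ox; apply: (@cvg_inve_subr _ (fun k => w (lambda_seq k) x)).
    by move=> k; exact: branch_lt1.
  exact: cvg_branch_seq.
have -> : gap_integral Omega w_star =
    (\int[mu]_(x in Omega) limn (fun k => (1 - w (lambda_seq k) x)%:E^-1))%E.
  apply: eq_integral => x /[!inE] Ox; apply/esym/cvg_lim => //.
  exact: gap_cvg.
apply: cvg_monotone_convergence => //.
- by move=> k; exact: measurable_branch_gap.
- move=> k x Ox; rewrite inve_subr_lt1 ?branch_lt1//.
  by rewrite lee_fin invr_ge0 subr_ge0 ltW// branch_lt1.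
- move=> x Ox i j ij; rewrite !inve_subr_lt1 ?branch_lt1// lee_fin.
  rewrite lef_pV2 ?posrE ?subr_gt0 ?branch_lt1// lerD2l lerN2 branch_le//.
  + by have /andP[] := lambda_seq_itv i.
  + exact: lambda_seq_nd.
  + by have /andP[] := lambda_seq_itv j.
Qed.

(** The sequence eventually exceeds [l], so by monotonicity the gap integral at [l] is eventually
    below terms that converge to the one of [w_star]. *)
Lemma branch_gap_le_star l : 0 < l < lambda_star ->
  (gap_integral Omega (w l) <= gap_integral Omega w_star)%E.
Proof.
move=> /andP[l0 ls]; apply: cvge_ge cvg_branch_gap.
apply: filterS (cvgr_gt lambda_star cvg_lambda_seq l ls) => k lk.
by apply: branch_gap_le => //; [exact: ltW|have /andP[] := lambda_seq_itv k].
Qed.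

(** * Finiteness and continuity of the gap integral along the branch *)

Context (gap_star_fin : (gap_integral Omega w_star < +oo)%E).

Lemma branch_gap_fin_num l : 0 < l < lambda_star ->
  gap_integral Omega (w l) \is a fin_num.
Proof.
move=> /[dup] ls /andP[l0 l1]; rewrite ge0_fin_numE.
  exact: le_lt_trans (branch_gap_le_star ls) gap_star_fin.
by rewrite branch_gap_ge0// l1 ltW.
Qed.

Lemma integrable_branch_gap l : 0 < l < lambda_star ->
  mu.-integrable Omega (EFin \o (fun x => (1 - w l x)^-1)).
Proof.
move=> ls; have lsW : 0 <= l < lambda_star by have /andP[/ltW -> ->] := ls.
have e x : Omega x -> ((1 - w l x)%:E^-1)%E = ((1 - w l x)^-1)%:E.
  by move=> Ox; rewrite inve_subr_lt1// branch_lt1.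
apply/integrableP; split.
  apply: eq_measurable_fun (measurable_branch_gap lsW) => x /[!inE] Ox.
  by rewrite e.
have := branch_gap_fin_num ls; rewrite ge0_fin_numE ?branch_gap_ge0//.
apply: le_lt_trans; rewrite le_eqVlt; apply/orP; left; apply/eqP.
apply: eq_integral => x /[!inE] Ox; rewrite e//= ger0_norm// invr_ge0.
by rewrite subr_ge0 ltW// branch_lt1.
Qed.

Let gap l : R := fine (gap_integral Omega (w l)).

Lemma continuous_branch_gap l : 0 < l < lambda_star ->
  {for l, continuous gap}.
Proof.
(* On []0, m[] the integrands are dominated by the one at [m], which is integrable since [m] is
   still below [lambda_star]. *)
move=> /andP[l0 ls]; pose m := (l + lambda_star) / 2.
have lm : l < m by rewrite midf_lt.
have ms : m < lambda_star by rewrite midf_lt.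
have m0 : 0 < m by exact: lt_trans lm.
have itv k : k \in `]0, m[ -> 0 < k < lambda_star.
  by rewrite in_itv/= => /andP[-> km]; exact: lt_trans ms.
have gapE : {in `]0, m[, gap =1 fun k => \int[mu]_(x in Omega) (1 - w k x)^-1}.
  move=> k /itv/andP[k0 ks]; rewrite /gap /Rintegral; congr fine.
  by apply: eq_integral => x /[!inE] Ox; rewrite inve_subr_lt1// branch_lt1 ?ks ?ltW.
have lI : l \in `]0, m[ by rewrite in_itv/= l0.
have : {for l, continuous (fun k => \int[mu]_(x in Omega) (1 - w k x)^-1)}.
  apply: (@continuity_under_integral _ _ _ mu (fun k x => (1 - w k x)^-1)
    _ mOmega 0 m _ _ (fun x => (1 - w m x)^-1)).
  - by move=> k /itv; exact: integrable_branch_gap.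
  - apply: aeW => x Ox k; rewrite inE => /itv ks.
    have kW : 0 <= k < lambda_star by have /andP[/ltW -> ->] := ks.
    apply: continuous_inv_subr; first by rewrite lt_eqF ?branch_lt1.
    exact: branch_continuous.
  - by apply: integrable_branch_gap; rewrite m0.
  - move=> k kI; have /andP[k0 ks] := itv _ kI.
    have kW : 0 <= k < lambda_star by rewrite ltW.
    have mW : 0 <= m < lambda_star by rewrite ltW.
    have km : k <= m by move: kI; rewrite /= in_itv/= => /andP[_ /ltW].
    apply: aeW => x Ox.
    have h (j : R) : 0 <= j < lambda_star -> 0 < 1 - w j x.
      by move=> js; rewrite subr_gt0 branch_lt1.
    rewrite ger0_norm; last by rewrite invr_ge0 ltW// h.
    rewrite lef_pV2 ?posrE ?h//.
    by rewrite lerD2l lerN2 branch_le.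
  - by rewrite inE.
(* [gap] is identified with the real-valued integral only on []0, m[]; this is a neighbourhood of
   [l], so continuity carries over. *)
rewrite /prop_for/continuous_at -gapE//; apply: cvg_trans.
apply: near_eq_cvg; near=> k; apply/esym/gapE.
by near: k; exact: near_in_itvoo.
Unshelve. all: by end_near. Qed.

(** * The nonlocal parameter along the branch and the intermediate value argument *)

Context (chi : R) (chi0 : 0 < chi).
Let gap_star : R := fine (gap_integral Omega w_star).

Lemma gap_star_ge0 : 0 <= gap_star.
Proof. by apply: fine_ge0; apply: gap_integral_ge0; exact: w_star_le1. Qed.

(** The parameter for which [w l] solves the nonlocal problem. *)
Let level l := l * (1 + chi * gap l) ^+ 2.

Lemma continuous_level l : 0 < l < lambda_star -> {for l, continuous level}.
Proof.
move=> ls; apply: cvgM; first exact: cvg_id.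
apply: (@continuous_comp _ _ _ (fun k => 1 + chi * gap k) (fun y => y ^+ 2)).
  apply: cvgD; first exact: cvg_cst.
  by apply: cvgM; [exact: cvg_cst|exact: continuous_branch_gap].
exact: exprn_continuous.
Qed.

Lemma cvg_level : level (lambda_seq k) @[k --> \oo] -->
  lambda_star * (1 + chi * gap_star) ^+ 2.
Proof.
have cvg_gap : gap (lambda_seq k) @[k --> \oo] --> gap_star.
  apply: fine_cvg; rewrite fineK; first exact: cvg_branch_gap.
  by rewrite ge0_fin_numE// gap_integral_ge0//; exact: w_star_le1.
apply: cvgM; first exact: cvg_lambda_seq.
have c : 1 + chi * gap (lambda_seq k) @[k --> \oo] --> 1 + chi * gap_star.
  apply: cvgD; first exact: cvg_cst.
  by apply: cvgM; [exact: cvg_cst|exact: cvg_gap].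
exact: (cvgM c c).
Qed.

(** This linear bound makes [level] small near 0, in place of continuity at 0, and so supplies the
    lower end for the intermediate value theorem. *)
Lemma level_le l : 0 < l < lambda_star ->
  level l <= l * (1 + chi * gap_star) ^+ 2.
Proof.
move=> /[dup] ls /andP[l0 l1].
have lsW : 0 <= l < lambda_star by rewrite ltW.
have g0 : 0 <= gap l by exact/fine_ge0/branch_gap_ge0.
have chiW : 0 <= chi by exact: ltW.
rewrite ler_pM2l// ler_sqr ?nnegrE ?addr_ge0 ?mulr_ge0 ?gap_star_ge0//.
rewrite lerD2l ler_pM2l// fine_le ?branch_gap_fin_num ?branch_gap_le_star//.
by rewrite ge0_fin_numE// gap_integral_ge0//; exact: w_star_le1.
Qed.

Lemma nonlocal_solvable_lt_bound l :
  0 <= l < lambda_star * (1 + chi * gap_star) ^+ 2 ->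
  nonlocal_solvable Omega chi l.
Proof.
have ls0 := pull_in_gt0 branch; move=> /andP[].
(* The parameter 0 is treated apart, with [w 0]; the intermediate value argument runs over positive
   parameters. *)
rewrite le_eqVlt => /predU1P[<- _|l0 lb].
  have z : 0 <= (0 : R) < lambda_star by rewrite lexx.
  by exists (w 0); have := local_solution_nonlocal chi0 (branch_solution z); rewrite mul0r.
have [k lk] : exists k, l < level (lambda_seq k).
  have [k _ h] := cvgr_gt _ cvg_level l lb.
  by exists k; exact: (h k (leqnn k)).
have /andP[b0 bs] := lambda_seq_itv k; set b := lambda_seq k in lk b0 bs.
pose K := (1 + chi * gap_star) ^+ 2.
have K0 : 0 < K.
  by rewrite exprn_gt0// ltr_pwDl// mulr_ge0 ?gap_star_ge0// ltW.
(* By [level_le], [level a <= a * K], which is at most [l] since [a <= l / K]; the minimum with [b]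
   makes [[a, b]] an interval. *)
pose a := Num.min b (l / K).
have a0 : 0 < a by rewrite lt_min b0 divr_gt0.
have ab : a <= b by rewrite ge_min lexx.
have al : level a <= l.
  apply: le_trans (level_le _) _; first by rewrite a0 (le_lt_trans ab).
  by rewrite -ler_pdivlMr// ge_min lexx orbT.
have itv c : c \in `[a, b] -> 0 < c < lambda_star.
  by rewrite in_itv/= => /andP[ac cb]; rewrite (lt_le_trans a0)//= (le_lt_trans cb).
have [||c cab <-] := @IVT _ level a b l ab.
- by apply: continuous_in_subspaceT => c /[!inE] /itv; exact: continuous_level.
- by rewrite ge_min le_max al (ltW lk) orbT.
have /andP[c0 cs] := itv _ cab.
by exists (w c); apply/local_solution_nonlocal/branch_solution; rewrite // ltW.
Qed.

End pull_in_branch.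

Theorem mainTheorem1 (R : realType) (n : nat) (Omega : set 'rV[R]_n)
    (chi lambda_star : R) (w : R -> 'rV[R]_n -> R)
    (w_star := pull_in_limit lambda_star w)
    (bound := (lambda_star%:E *
                 (1 + chi%:E * gap_integral Omega w_star) ^+ 2)%E) :
  (0 < n)%N ->
  bounded_C2_domain Omega ->
  0 < chi ->
  pull_in_branch Omega lambda_star w ->
  (gap_integral Omega w_star < +oo)%E ->
  [/\ (nonlocal_threshold Omega chi <= nonlocal_unsolvable_threshold Omega chi)%E,
      (bound <= nonlocal_threshold Omega chi)%E,
      (0 < bound)%E,
      (forall lambda, 0 <= lambda -> (lambda%:E < nonlocal_threshold Omega chi)%E ->
         nonlocal_solvable Omega chi lambda) &
      (forall lambda, (nonlocal_unsolvable_threshold Omega chi < lambda%:E)%E ->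
         ~ nonlocal_solvable Omega chi lambda)].
Proof.
move=> _ [_ oOmega _ _ _] chi0 branch gap_fin.
have ls0 := pull_in_gt0 branch.
have g0 := gap_star_ge0 branch.
(* Finiteness of the gap integral of [w_star] turns the extended bound into the real one of the
   preceding lemmas. *)
have boundE : bound =
    (lambda_star * (1 + chi * fine (gap_integral Omega w_star)) ^+ 2)%:E.
  rewrite /bound -[in LHS](@fineK _ (gap_integral Omega w_star)).
    by rewrite EFinM EFin_expe EFinD EFinM.
  by rewrite ge0_fin_numE// gap_integral_ge0//; exact: w_star_le1.
have bound0 : (0 < bound)%E.
  by rewrite boundE lte_fin mulr_gt0// exprn_gt0// ltr_pwDl// mulr_ge0// ltW.
split=> //.
- exact: nonlocal_threshold_le.
- rewrite boundE; apply: nonlocal_threshold_ge; first by rewrite -lte_fin -boundE.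
  exact: nonlocal_solvable_lt_bound.
- by move=> l; exact: nonlocal_solvable_below.
- by move=> l; exact: nonlocal_unsolvable_above.
Qed.
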